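(* For every $t\geq 2$ and $r\geq 3$, $\mathrm{ex}(n,C_{2t}^{(r)})=\Theta_r(tn^{r-1})$. That is, for every integer $r\geq 3$ there are constants $c_r,C_r>0$ depending only on $r$ such that for every integer $t\geq 2$ and all $n$ sufficiently large (in terms of $r$ and $t$), $$c_r\,tn^{r-1}\leq \mathrm{ex}(n,C_{2t}^{(r)})\leq C_r\,tn^{r-1}.$$
   Context: For an $r$-uniform hypergraph $H$, $\mathrm{ex}(n,H)$ denotes the largest number of edges in an $r$-uniform hypergraph on $n$ vertices containing no copy of $H$ (as a not necessarily induced subhypergraph). $C_{2t}^{(r)}$ denotes the following $r$-uniform hypergraph obtained from the cycle of length $2t$: its vertex set is the union of pairwise disjoint sets $X=\{x_1,\dots,x_t\}$ (with $|X|=t$) and $Y_1,\dots,Y_t$ with $|Y_1|=\dots=|Y_t|=r-1$, and its edges are $\{x_i\}\cup Y_i$ and $\{x_{i+1}\}\cup Y_i$ for $1\leq i\leq t$, where $x_{t+1}=x_1$. *)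

(* Defs.v *)
From mathcomp Require Import all_boot.

Set Implicit Arguments.
Unset Strict Implicit.
Unset Printing Implicit Defensive.

(* A hypergraph with vertex set T is given by its edge set {set {set T}}. *)
Definition uniform (T : finType) (r : nat) (G : {set {set T}}) : bool :=
  [forall e in G, #|e| == r].

(* Copies are not required to be induced. *)
Definition contains_copy (V T : finType)
    (H : {set {set V}}) (G : {set {set T}}) : bool :=
  [exists f : {ffun V -> T},
    injectiveb f && [forall e in H, f @: e \in G]].

Definition ex_number (r n : nat) (V : finType) (H : {set {set V}}) : nat :=
  \max_(G : {set {set 'I_n}} | uniform r G && ~~ contains_copy H G) #|G|.

(* inl i is x_i and inr (i, j), with j < r - 1, are the elements of Y_i;
   indices i range over 0, ..., t - 1 rather than 1, ..., t. *)
Definition cycle_vertex (r t : nat) : finType := ('I_t + 'I_t * 'I_r.-1)%type.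

Definition cycle_block (r t : nat) (i : 'I_t) : {set cycle_vertex r t} :=
  [set inr (i, j) | j : 'I_r.-1].

(* ordS is the successor modulo t. *)
Definition even_cycle (r t : nat) : {set {set cycle_vertex r t}} :=
  [set inl i |: cycle_block r i | i : 'I_t]
    :|: [set inl (ordS i) |: cycle_block r i | i : 'I_t].

(* Main.v *)
Require Import Defs.
From mathcomp Require Import all_boot all_order all_algebra.
From mathcomp Require Import reals.
From mathcomp Require Import zify ring lra.

(* Lower bound: fix a set S of t - 1 vertices and take all edges meeting S in
   exactly one vertex.

   Upper bound: in each edge e of G choose as apex a vertex x maximising the
   degree d(e - x) of the remaining (r-1)-set, and let A(Y) consist of the x that
   are the apex of x + Y.  A pair a, a' is avoidable if every set of at most rt
   vertices is missed by some Y with a, a' in A(Y).  If a, a' is not avoidable,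
   a set of rt vertices meets all such Y; since the sum of 1/d(Y) over the Y
   containing v with a in A(Y) is at most n^(r-3), the number of unavoidable pairs
   in A(Y), weighted by 1/d(Y), sums to at most rt n^(r-1) over all Y.  When
   |G| is larger than C_r t n^(r-1), some A(Y) with more than 4t elements thus
   has almost all its pairs avoidable.  It contains a cyclic sequence x_1, ..., x_t
   with all consecutive pairs avoidable, and disjoint sets Y_i completing it to a
   copy of the cycle are then chosen greedily. *)

Set Implicit Arguments.
Unset Strict Implicit.
Unset Printing Implicit Defensive.

Import Order.TTheory GRing.Theory Num.Theory.
Local Open Scope ring_scope.

(** * Elementary counting bounds *)

Lemma ffact_geq (m k : nat) : ((m - k) ^ k <= m ^_ k)%N.
Proof.
elim: k => [|k IHk]; first by rewrite ffactn0.
rewrite ffactnSr expnSr leq_mul //; last by lia.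
by apply: leq_trans IHk; case: k => // k; rewrite leq_exp2r //; lia.
Qed.

Lemma card_draws_leq (T : finType) (k : nat) :
  (#|[set Y : {set T} | #|Y| == k]| <= #|T| ^ k)%N.
Proof.
rewrite card_draws.
apply: leq_trans (_ : #|T| ^_ k <= _)%N; first by rewrite -bin_ffact leq_pmulr ?fact_gt0.
elim: k => [|k IHk]; first by rewrite ffactn0.
by rewrite ffactnSr expnSr leq_mul ?leq_subr.
Qed.

Lemma card_draws_mem_leq (T : finType) (v : T) (k : nat) :
  (#|[set Y : {set T} | (v \in Y) && (#|Y| == k.+1)]| <= #|T| ^ k)%N.
Proof.
apply: leq_trans (card_draws_leq T k).
rewrite -(@card_in_imset _ _ (fun Y : {set T} => Y :\ v)); last first.
  move=> Y Z; rewrite !inE => /andP[vY _] /andP[vZ _] eYZ.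
  by rewrite -(setD1K vY) -(setD1K vZ) eYZ.
apply/subset_leq_card/subsetP => _ /imsetP[Y + ->]; rewrite !inE.
by case/andP=> vY; rewrite (cardsD1 v) vY.
Qed.

(** For each x, deleting x maps the sets containing x bijectively onto the sets avoiding x. *)
Lemma exchange_setU1 (R : nmodType) (T : finType) (F : T -> {set T} -> R) :
  \sum_(Y : {set T}) \sum_(x in Y) F x (Y :\ x)
    = \sum_(Y : {set T}) \sum_(x | x \notin Y) F x Y.
Proof.
rewrite (exchange_big_dep predT) //= [RHS](exchange_big_dep predT) //=.
apply: eq_bigr => x _.
rewrite [RHS](reindex_onto (fun Y => Y :\ x) (fun Y => x |: Y)) /=; last first.
  by move=> Y xY; rewrite setU1K.
apply: eq_bigl => Y; rewrite !inE eqxx /=.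
by apply/idP/eqP => [/setD1K //|<-]; rewrite setU11.
Qed.

(** * Apexes of edges and unavoidable pairs *)

Section Apex.
Variables (T : finType) (G : {set {set T}}).
Implicit Types (x y : T) (e Y W : {set T}).

(** The size of [nbr Y] is the degree d(Y), and [apex_nbr Y] below is A(Y). *)
Definition nbr Y : {set T} := [set x | (x \notin Y) && (x |: Y \in G)].

(** Several vertices may attain the maximum; [pick] selects one, so that each nonempty edge has
    exactly one apex. *)
Definition apex e : option T :=
  [pick x in e | [forall y in e, #|nbr (e :\ y)| <= #|nbr (e :\ x)|]%N].

Definition apex_nbr Y : {set T} := [set x in nbr Y | apex (x |: Y) == Some x].

Lemma apex_exists e : e != set0 -> exists2 x, x \in e & apex e = Some x.
Proof.
case/set0Pn=> x0 x0e; rewrite /apex; case: pickP => [x /andP[xe _]|]; first by exists x.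
case: (arg_maxnP (fun x => #|nbr (e :\ x)|) x0e) => x; rewrite -/(x \in e) => xe xmax /(_ x).
by rewrite xe => /negbT/negP[]; apply/forall_inP; apply: xmax.
Qed.

Lemma apex_nbr_mem Y x : x \in apex_nbr Y -> (x \notin Y) /\ x |: Y \in G.
Proof. by rewrite !inE => /andP[/andP[]]. Qed.

Lemma apex_nbr_sub Y : apex_nbr Y \subset nbr Y.
Proof. by apply/subsetP => x; rewrite inE => /andP[]. Qed.

(** The edge consists of a, c and W: deleting c leaves [a |: W], and deleting its apex a leaves
    [c |: W]. *)
Lemma apex_nbr_max W a c : c \notin W -> a \in apex_nbr (c |: W) ->
  (#|nbr (a |: W)| <= #|nbr (c |: W)|)%N.
Proof.
move=> cW; rewrite inE => /andP[]; rewrite !inE negb_or => /andP[/andP[ac aW] _].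
rewrite /apex; case: pickP => // x /andP[_ /forall_inP/(_ c)] + /eqP[exa].
rewrite {x}exa setU1K ?inE ?negb_or ?ac // setUCA setU1K.
  by apply; rewrite eqxx orbT.
by rewrite !inE negb_or eq_sym ac.
Qed.

(** Both sides count the pairs of an edge e and a vertex x of e with [P x e]; the left side groups
    them by Y = e - x. *)
Lemma sum_nbr (P : T -> {set T} -> bool) :
  (\sum_Y #|[set x in nbr Y | P x (x |: Y)]| = \sum_(e in G) #|[set x in e | P x e]|)%N.
Proof.
transitivity (\sum_(Y : {set T}) \sum_(x | x \notin Y) (x |: Y \in G) && P x (x |: Y) : nat)%N.
  apply: eq_bigr => Y _; rewrite -sum1_card big_mkcond [RHS]big_mkcond /=.
  by apply: eq_bigr => x _; rewrite !inE; case: (x \in Y) => //=; case: ifP => [->|->].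
rewrite -(@exchange_setU1 nat _ (fun x (Y : {set T}) => ((x |: Y \in G) && P x (x |: Y) : nat))).
rewrite [RHS]big_mkcond /=; apply: eq_bigr => e _.
under eq_bigr => x xe do rewrite setD1K //.
case: (e \in G) => /=; last by rewrite big1.
rewrite -sum1_card big_mkcond [RHS]big_mkcond /=.
by apply: eq_bigr => x _; rewrite inE; case: (x \in e) => //=; case: (P x e).
Qed.

Variable r : nat.
Hypothesis Gr : uniform r G.

Lemma sum_card_nbr : (\sum_Y #|nbr Y| = #|G| * r)%N.
Proof.
have := sum_nbr (fun _ _ => true).
rewrite (eq_bigr (fun Y => #|nbr Y|)) => [->|Y _]; last first.
  by apply: eq_card => x; rewrite inE andbT.
rewrite -sum_nat_const; apply: eq_bigr => e eG.
rewrite -(eqP (forall_inP Gr e eG)).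
by apply: eq_card => x; rewrite inE andbT.
Qed.

(** Each edge is counted once, at the set left by deleting its apex. *)
Lemma sum_card_apex_nbr : (0 < r)%N -> (\sum_Y #|apex_nbr Y| = #|G|)%N.
Proof.
move=> r0; rewrite (sum_nbr (fun x e => apex e == Some x)) -sum1_card.
apply: eq_bigr => e eG.
have [|x xe ex] := @apex_exists e.
  by rewrite -card_gt0 (eqP (forall_inP Gr e eG)).
rewrite -(cards1 x); apply: eq_card => y; rewrite !inE ex.
by apply/andP/eqP => [[_ /eqP[]]|->].
Qed.

Lemma card_apex_nbr_set Y x : x \in apex_nbr Y -> #|Y| = r.-1.
Proof.
by case/apex_nbr_mem=> xY /(forall_inP Gr)/eqP <-; rewrite cardsU1 xY.
Qed.

(* The maximality of the apex compares [nbr Y] with [nbr (a |: Y :\ c)] for any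
   c != v in Y; the latter set has at most one Y for each of its elements c. *)
Lemma sum_inv_nbr_leq (R : realFieldType) a v : (3 <= r)%N ->
  \sum_(Y : {set T} | (v \in Y) && (a \in apex_nbr Y)) (#|nbr Y|%:R : R)^-1
    <= (#|T| ^ (r - 3))%:R.
Proof.
move=> r3.
(* Here W stands for Y - c. The weight involves [a |: W], so it does not depend on c, and the sum
   over c is at most 1 for each W. *)
pose F c W : R := if [&& v \in W & a \in apex_nbr (c |: W)]
                  then (#|nbr (a |: W)|%:R)^-1 else 0.
have F0 c W : 0 <= F c W by rewrite /F; case: ifP => // _; rewrite invr_ge0.
apply: le_trans (_ : \sum_(Y : {set T}) \sum_(c in Y) F c (Y :\ c) <= _).
  rewrite big_mkcond /=; apply: ler_sum => Y _.
  case: ifP => [/andP[vY aY]|_]; last by apply: sumr_ge0.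
  (* Since Y has r - 1 >= 2 elements, some c in Y differs from v. *)
  have /card_gt0P[c] : (0 < #|Y :\ v|)%N.
    by have := cardsD1 v Y; rewrite vY (card_apex_nbr_set aY); lia.
  rewrite !inE => /andP[cv cY].
  rewrite (bigD1 c) //= ler_wpDr ?sumr_ge0 //.
  have aY' : a \in apex_nbr (c |: Y :\ c) by rewrite setD1K.
  rewrite /F in_setD1 eq_sym cv vY aY' /=.
  have cYc : c \notin Y :\ c by rewrite !inE eqxx.
  rewrite lef_pV2 ?posrE ?ltr0n ?ler_nat.
  - by rewrite -{2}(setD1K cY) apex_nbr_max.
  - by apply/card_gt0P; exists a; apply: (subsetP (apex_nbr_sub Y)).
  - have [aY0 aG] := apex_nbr_mem aY.
    apply/card_gt0P; exists c; rewrite !inE eqxx orbF setUCA setD1K // aG andbT.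
    by apply: contraNneq aY0 => <-.
rewrite exchange_setU1.
(* Only the sets W of size r - 2 that contain v contribute. *)
apply: le_trans (_ : (\sum_(W : {set T} | (v \in W) && (#|W| == (r - 3).+1)) 1)%:R <= _); last first.
  rewrite ler_nat sum1_card; apply: leq_trans (card_draws_mem_leq v _).
  by apply/subset_leq_card/subsetP => W; rewrite !inE.
rewrite natr_sum [leRHS]big_mkcond /=; apply: ler_sum => W _.
have [/card0_eq W0|] := posnP #|[set c | (c \notin W) && (F c W != 0)]|.
  rewrite big1; first by case: ifP.
  by move=> c cW; apply/eqP; move: (W0 c); rewrite !inE cW /= => /negbFE.
case/card_gt0P=> c0; rewrite !inE {1}/F => /andP[c0W].
case: ifP => [/andP[vW aW] _|]; last by rewrite eqxx.
have -> : #|W| = (r - 3).+1.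
  by have := cardsU1 c0 W; rewrite c0W (card_apex_nbr_set aW); lia.
rewrite vW eqxx /=.
apply: le_trans (_ : \sum_(c in nbr (a |: W)) (#|nbr (a |: W)|%:R)^-1 <= _); last first.
  rewrite sumr_const -[leLHS]mulr_natr; have [->|n0] := posnP #|nbr (a |: W)|.
    by rewrite mulr0.
  by rewrite mulVf // pnatr_eq0 -lt0n.
rewrite big_mkcond [leRHS]big_mkcond /=; apply: ler_sum => c _.
case: ifP => [cW|_]; last by case: ifP; rewrite ?invr_ge0.
rewrite {1}/F; case: ifP => [/andP[_ ac]|_]; last by case: ifP; rewrite ?invr_ge0.
have [aY0 aG] := apex_nbr_mem ac.
rewrite ifT // !inE setUCA aG andbT negb_or cW andbT.
by apply: contraNneq aY0 => ->; rewrite setU11.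
Qed.

Definition avoidable q a a' : bool :=
  [forall S : {set T}, (#|S| <= q)%N ==>
    [exists Y : {set T}, [&& a \in apex_nbr Y, a' \in apex_nbr Y & [disjoint Y & S]]]].

Lemma avoidableC q : symmetric (avoidable q).
Proof.
move=> a a'; apply: eq_forallb => S; congr (_ ==> _).
by apply: eq_existsb => Y; rewrite andbCA.
Qed.

Definition unavoidable_pairs q Y : {set T * T} :=
  [set p | [&& p.1 \in apex_nbr Y, p.2 \in apex_nbr Y & ~~ avoidable q p.1 p.2]].

(** Each of the n^2 ordered pairs contributes at most q n^(r-3): if it is not avoidable, at most q
    vertices meet all Y concerned, and [sum_inv_nbr_leq] bounds the share of each vertex. *)
Lemma sum_unavoidable_pairs_leq (R : realFieldType) q : (3 <= r)%N ->
  \sum_(Y : {set T}) #|unavoidable_pairs q Y|%:R / (#|nbr Y|%:R : R)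
    <= (q * #|T| ^ r.-1)%:R.
Proof.
move=> r3.
apply: le_trans (_ : \sum_(p : T * T) (q * #|T| ^ (r - 3))%:R <= _); last first.
  rewrite sumr_const card_prod -mulrnA ler_nat.
  have -> : r.-1 = (r - 3).+2 by lia.
  by rewrite eq_leq // !expnS; ring.
under eq_bigr => Y _ do rewrite mulr_natl -sumr_const big_mkcond /=.
rewrite exchange_big /=; apply: ler_sum => -[a a'] _.
rewrite -big_mkcond /=.
have [av|nav] := boolP (avoidable q a a').
  rewrite big_pred0 // => Y; rewrite !inE /= av.
  by rewrite !andbF.
move: (nav); rewrite negb_forall => /existsP[S]; rewrite negb_imply => /andP[Sq].
rewrite negb_exists => /forallP hitS.
apply: le_trans (_ : \sum_(v in S) (#|T| ^ (r - 3))%:R <= _); last first.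
  by rewrite sumr_const -mulrnA ler_nat mulnC leq_mul2r Sq orbT.
apply: le_trans (ler_sum _ (fun v _ => sum_inv_nbr_leq R a v r3)).
under [leRHS]eq_bigr => v _ do rewrite big_mkcond /=.
rewrite exchange_big /= big_mkcond; apply: ler_sum => Y _.
have pos v : 0 <= if (v \in Y) && (a \in apex_nbr Y) then (#|nbr Y|%:R : R)^-1 else 0.
  by case: ifP; rewrite ?invr_ge0.
case: ifP; last by rewrite sumr_ge0.
rewrite inE /= => /and3P[aY a'Y _].
have := hitS Y; rewrite aY a'Y /= -setI_eq0 => /set0Pn[v /setIP[vY vS]].
rewrite (bigD1 v) //= vY ler_wpDr // sumr_ge0 // => i _.
by case: ifP; rewrite ?invr_ge0.
Qed.

End Apex.

(** * Greedy choices *)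

(** Fewer than a quarter of the vertices of A have nonadjacencies to at least a quarter of A. Any
    two of the other vertices have a common neighbour among these others, outside any given list of
    at most t vertices. *)
Lemma greedy_closed_walk (T : finType) (A : {set T}) (adj : rel T) (t : nat) :
  symmetric adj -> (1 < t)%N -> (4 * t < #|A|)%N ->
  (16 * #|[set p | [&& p.1 \in A, p.2 \in A & ~~ adj p.1 p.2]]| < #|A| ^ 2)%N ->
  exists x : 'I_t -> T,
    injective x /\ forall i, (x i \in A) && adj (x i) (x (ordS i)).
Proof.
move=> adjC t1 tA fewbad.
pose nonadj a := [set a' in A | ~~ adj a a'].
pose A' := [set a in A | (4 * #|nonadj a| < #|A|)%N].
have sumE : (#|[set p | [&& p.1 \in A, p.2 \in A & ~~ adj p.1 p.2]]|
    = \sum_(a in A) #|nonadj a|)%N.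
  under [RHS]eq_bigr => a _ do rewrite -sum1_card.
  by rewrite pair_big_dep -sum1_card; apply: eq_bigl => p; rewrite !inE.
have A'big : (4 * #|A :\: A'| < #|A|)%N.
  have : (#|A :\: A'| * #|A| <= 4 * \sum_(a in A) #|nonadj a|)%N.
    rewrite -sum_nat_const big_distrr /= big_mkcond [leqRHS]big_mkcond /=.
    apply: leq_sum => a _; rewrite !inE.
    by case: (a \in A) => //=; rewrite andbT -leqNgt; case: ifP.
  by move: fewbad; rewrite sumE; nia.
have next (s : seq T) a b : (size s <= t)%N -> a \in A' -> b \in A' ->
    exists c, [/\ c \in A', c \notin s, adj a c & adj b c].
  move=> st; rewrite !inE => /andP[_ ba] /andP[_ bb].
  (* Each of the four sets has fewer than |A|/4 elements. *)
  pose U := (A :\: A') :|: [set c in s] :|: nonadj a :|: nonadj b.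
  have UA : (#|U| < #|A|)%N.
    have := (leq_card_setU ((A :\: A') :|: [set c in s] :|: nonadj a) (nonadj b)).1.
    have := (leq_card_setU ((A :\: A') :|: [set c in s]) (nonadj a)).1.
    have := (leq_card_setU (A :\: A') [set c in s]).1.
    have : (#|[set c in s]| <= size s)%N by rewrite cardsE card_size.
    by rewrite -/U => *; lia.
  have /subsetPn[c cA] : ~~ (A \subset U).
    by apply: contraTN UA => /subset_leq_card; rewrite leqNgt.
  rewrite /U !inE cA /= !andbT !negb_or !negbK => /andP[/andP[/andP[cA' cs] ca] cb].
  by exists c; rewrite !inE cA cA'.
have A'A : {subset A' <= A} by move=> a; rewrite inE => /andP[].
have /card_gt0P[x0 x0A'] : (0 < #|A'|)%N.
  by move/subsetP/setIidPr: A'A => sA; move: (cardsID A' A); rewrite sA; lia.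
(* All vertices are adjacent to x0, so the walk may be closed at any length. *)
have [s [size_s path_s uniq_s all_s]] : exists s, [/\ size s = t.-1, path adj x0 s,
    uniq (x0 :: s) & all (fun c => (c \in A') && adj x0 c) s].
  have: (t.-1 <= t.-1)%N by [].
  elim: {1 3}t.-1 => [|k IHk] kt; first by exists [::].
  have [s [size_s path_s uniq_s all_s]] := IHk (ltnW kt).
  have lastA' : last x0 s \in A'.
    case/lastP: s all_s {size_s path_s uniq_s} => // s y.
    by rewrite all_rcons last_rcons => /andP[/andP[]].
  have [|c [cA' cs a1 a2]] := next (x0 :: s) (last x0 s) x0 _ lastA' x0A'.
    by rewrite /= size_s; lia.
  exists (rcons s c); split.
  - by rewrite size_rcons size_s.
  - by rewrite rcons_path path_s.
  - by rewrite -rcons_cons rcons_uniq cs.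
  - by rewrite all_rcons cA' a2.
have sz : size (x0 :: s) = t by rewrite /= size_s; lia.
exists (fun i : 'I_t => nth x0 (x0 :: s) i); split.
  move=> i j /eqP; rewrite nth_uniq ?sz ?ltn_ord // => /eqP ij; exact: val_inj.
move=> i; apply/andP; split.
  have : nth x0 (x0 :: s) i \in x0 :: s by rewrite mem_nth ?sz.
  by rewrite inE => /orP[/eqP->|/(allP all_s)/andP[/A'A]] //; apply: A'A.
(* The last index wraps around to 0; as t > 1, the last vertex lies in s and is thus adjacent to
   x0. *)
rewrite [val (ordS i)]/=; have := ltn_ord i; rewrite leq_eqVlt => /orP[/eqP it|it].
  rewrite it modnn /= adjC.
  have /(allP all_s)/andP[//] : nth x0 (x0 :: s) i \in s.
  have -> : i = (nat_of_ord i).-1.+1 :> nat by lia.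
  by rewrite /= mem_nth // size_s; lia.
rewrite modn_small //=.
by apply: (pathP x0 path_s); rewrite size_s; lia.
Qed.

(** The sets are chosen in the order of their indices: S and the earlier choices together have at
    most q vertices, so they can be avoided. *)
Lemma greedy_disjoint (T : finType) (k t q : nat) (S : {set T})
    (P : 'I_t -> pred {set T}) :
  (#|S| + k * t <= q)%N ->
  (forall i Y, P i Y -> #|Y| = k) ->
  (forall i (U : {set T}), (#|U| <= q)%N -> exists2 Y, P i Y & [disjoint Y & U]) ->
  exists Y : 'I_t -> {set T},
    (forall i, P i (Y i) /\ [disjoint Y i & S]) /\
    (forall i j, i != j -> [disjoint Y i & Y j]).
Proof.
move=> Sq Pk avoid.
suff /(_ t (leqnn t)) [Y [Y1 Y2]] : forall m, (m <= t)%N -> exists Y : 'I_t -> {set T},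
    (forall i : 'I_t, (i < m)%N -> P i (Y i) /\ [disjoint Y i & S]) /\
    (forall i j : 'I_t, (i < j)%N -> (j < m)%N -> [disjoint Y j & Y i]).
  exists Y; split=> [i|i j]; first exact: Y1.
  rewrite neq_ltn => /orP[] ij; last exact: Y2.
  by rewrite disjoint_sym; apply: Y2.
(* Nothing is required at indices from m on; [set0] is a placeholder. *)
elim=> [|m IHm] mt; first by exists (fun=> set0).
have [Y [Y1 Y2]] := IHm (ltnW mt).
pose U := S :|: \bigcup_(i < t | (i < m)%N) Y i.
have Uq : (#|U| <= q)%N.
  apply: leq_trans Sq; apply: leq_trans (leq_card_setU _ _) _; rewrite leq_add2l.
  apply: leq_trans (_ : \sum_(i < t | (i < m)%N) k <= _)%N; last first.
    by rewrite sum_nat_const mulnC leq_mul2l -[leqRHS](card_ord t) max_card orbT.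
  elim/big_ind2: _ => [|A a B b Aa Bb|i im]; first by rewrite cards0.
    by apply: leq_trans (leq_card_setU _ _) (leq_add _ _).
  by rewrite (Pk i) //; case: (Y1 i im).
have [Z PZ dZU] := avoid (Ordinal mt) U Uq.
exists (fun i => if i == Ordinal mt then Z else Y i); split=> [i|i j ij].
  rewrite ltnS leq_eqVlt => /orP[/eqP im|im].
    have -> : i = Ordinal mt by apply: val_inj.
    by rewrite eqxx; split=> //; apply: disjointWr dZU; apply: subsetUl.
  by case: eqP => [ei|_]; [move: im; rewrite ei ltnn | apply: Y1].
rewrite ltnS leq_eqVlt => /orP[/eqP jm|jm].
  have -> : j = Ordinal mt by apply: val_inj.
  rewrite eqxx ifF; last by apply/eqP => ei; move: ij; rewrite jm ei ltnn.
  apply: disjointWr dZU; apply/subsetU/orP; right.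
  by apply: (bigcup_sup i); rewrite -jm.
rewrite !ifF; first exact: Y2.
  by apply/eqP => ei; move: ij; rewrite ei ltnNge (ltnW jm).
by apply/eqP => ej; move: jm; rewrite ej ltnn.
Qed.

(** * The upper bound *)

Section EvenCycle.
Variables (T : finType) (G : {set {set T}}) (r t : nat).

(** Every edge of the cycle contains a whole block, so the blocks can be mapped onto the sets [Y i]
    by arbitrary enumerations. *)
Lemma contains_even_cycle (x : 'I_t -> T) (Y : 'I_t -> {set T}) :
  injective x -> (forall i, #|Y i| = r.-1) -> (forall i j, x i \notin Y j) ->
  (forall i j, i != j -> [disjoint Y i & Y j]) ->
  (forall i, (x i |: Y i \in G) && (x (ordS i) |: Y i \in G)) ->
  contains_copy (even_cycle r t) G.
Proof.
move=> x_inj cardY xY dY edges.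
pose g i (j : 'I_r.-1) := enum_val (cast_ord (esym (cardY i)) j).
have gY i j : g i j \in Y i by apply: enum_valP.
pose f : {ffun cycle_vertex r t -> T} := [ffun v =>
  match v with inl i => x i | inr (i, j) => g i j end].
have f_block i : f @: cycle_block r i = Y i.
  apply/setP => y; apply/imsetP/idP => [[_ /imsetP[j _ ->] ->]|yY].
    by rewrite ffunE.
  exists (inr (i, cast_ord (cardY i) (enum_rank_in yY y))).
    by apply/imsetP; eexists.
  by rewrite ffunE /g cast_ord_comp cast_ord_id enum_rankK_in.
apply/existsP; exists f; apply/andP; split.
  apply/injectiveP => -[i|[i j]] [i'|[i' j']]; rewrite !ffunE.
  - by move/x_inj->.
  - by move=> e; have := xY i i'; rewrite e gY.
  - by move=> e; have := xY i' i; rewrite -e gY.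
  - move=> e; have ii' : i = i'.
      apply/eqP/negPn/negP => /dY; rewrite -setI_eq0 => /eqP/setP/(_ (g i j)).
      by rewrite !inE gY e gY.
    by subst i'; move/enum_val_inj/cast_ord_inj: e => ->.
apply/forall_inP => e; rewrite inE => /orP[] /imsetP[i _ ->];
  by rewrite imsetU1 f_block ffunE; case/andP: (edges i).
Qed.

Hypothesis Gr : uniform r G.
Hypothesis G_free : ~~ contains_copy (even_cycle r t) G.

(** Otherwise [greedy_closed_walk] supplies the x_i and [greedy_disjoint] the Y_i of a copy of the
    cycle in G. *)
Lemma unavoidable_pairs_geq (Y : {set T}) : (0 < r)%N -> (1 < t)%N ->
  (4 * t < #|apex_nbr G Y|)%N ->
  (#|apex_nbr G Y| ^ 2 <= 16 * #|unavoidable_pairs G (r * t) Y|)%N.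
Proof.
move=> r0 t1 tY; rewrite leqNgt; apply: contra G_free => few.
have [x [x_inj xP]] := greedy_closed_walk (avoidableC G (r * t)) t1 tY few.
pose P i Z := (x i \in apex_nbr G Z) && (x (ordS i) \in apex_nbr G Z).
have [|i Z /andP[xZ _]|i U Uq|Z [ZP dZ]] :=
    @greedy_disjoint T r.-1 t (r * t) [set x i | i : 'I_t] P.
(* The cycle has t + (r - 1) t = r t vertices, whence the choice q = r t. *)
- by rewrite card_imset // card_ord -mulSn prednK.
- exact: card_apex_nbr_set Gr _ _ xZ.
- have /andP[_ /forallP/(_ U)] := xP i.
  by rewrite Uq => /existsP[Z /and3P[z1 z2 dZ]]; exists Z; rewrite // /P z1.
apply: (contains_even_cycle x_inj _ _ dZ) => [i|i j|i].
- by have [/andP[xZ _] _] := ZP i; apply: card_apex_nbr_set Gr _ _ xZ.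
- have [_] := ZP j; rewrite disjoint_sym disjoints_subset => /subsetP/(_ (x i)).
  by rewrite inE; apply; apply: imset_f.
- by have [/andP[/apex_nbr_mem[_ ->] /apex_nbr_mem[_ ->]] _] := ZP i.
Qed.

Lemma even_cycle_free_card_leq : (3 <= r)%N -> (1 < t)%N ->
  (#|G| <= (8 + 64 * r ^ 2) * t * #|T| ^ r.-1)%N.
Proof.
move=> r3 t1; have r0 : (0 < r)%N by lia.
pose m Y := #|apex_nbr G Y|; pose d Y := #|nbr G Y|.
pose b Y := #|unavoidable_pairs G (r * t) Y|.
have rQ : 0 < r%:R :> rat by rewrite ltr0n.
(* The three terms cover three cases: |A(Y)| <= 4t; d(Y) >= 2r |A(Y)|; and otherwise |A(Y)|^2 <= 16
   b(Y) with d(Y) < 2r |A(Y)|, so that |A(Y)| d(Y) <= 32 r b(Y). *)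
have pointwise Y : (m Y)%:R <= (if #|Y| == r.-1 then 4 * t%:R else 0)
    + (d Y)%:R / (2 * r%:R) + 32 * r%:R * ((b Y)%:R / (d Y)%:R) :> rat.
  have p1 : 0 <= (d Y)%:R / (2 * r%:R) :> rat by rewrite divr_ge0 // mulr_ge0 // ltW.
  have p2 : 0 <= 32 * r%:R * ((b Y)%:R / (d Y)%:R) :> rat.
    by rewrite mulr_ge0 ?divr_ge0 ?mulr_ge0 // ltW.
  have [/eqP m0|mpos] := posnP (m Y).
    rewrite (eqP m0) addr_ge0 // addr_ge0 //.
    by case: ifP => // _; rewrite mulr_ge0.
  have [a aY] := card_gt0P mpos.
  rewrite (card_apex_nbr_set Gr aY) eqxx.
  have [mt|mt] := leqP (m Y) (4 * t).
    by move: mt; rewrite -(ler_nat rat) natrM => mt; lra.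
  have md : (m Y <= d Y)%N by apply/subset_leq_card/apex_nbr_sub.
  have dpos : 0 < (d Y)%:R :> rat by rewrite ltr0n; lia.
  have t0 : 0 <= 4 * t%:R :> rat by rewrite mulr_ge0.
  have [rm|rm] := leqP (2 * r * m Y) (d Y).
    suff : (m Y)%:R <= (d Y)%:R / (2 * r%:R) :> rat by lra.
    rewrite ler_pdivlMr ?mulr_gt0 // -[2]/(2%:R) -!natrM ler_nat; lia.
  suff : (m Y)%:R <= 32 * r%:R * ((b Y)%:R / (d Y)%:R) :> rat by lra.
  rewrite mulrA ler_pdivlMr // -[32]/(32%:R) -!natrM ler_nat.
  have mb := unavoidable_pairs_geq r0 t1 mt; rewrite -/(m Y) -/(b Y) in mb.
  apply: (@leq_trans (2 * r * m Y ^ 2)); first by nia.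
  by nia.
have := ler_sum (index_enum _) (fun Y (_ : predT Y) => pointwise Y).
rewrite -natr_sum (sum_card_apex_nbr Gr r0) !big_split /= -big_mkcond /=.
rewrite sumr_const -mulr_suml -mulr_sumr.
have -> : \sum_Y (d Y)%:R = (#|G| * r)%:R :> rat by rewrite -natr_sum (sum_card_nbr Gr).
(* The middle terms sum to |G|/2. Moving this to the left doubles the coefficients 4 and 32 r^2 of
   the other two terms. *)
have -> : (#|G| * r)%:R / (2 * r%:R) = #|G|%:R / 2 :> rat.
  by rewrite natrM; field; rewrite lt0r_neq0.
have := sum_unavoidable_pairs_leq Gr rat (r * t) r3.
set B := \sum_Y _; rewrite -/B => Bb.
have := card_draws_leq T r.-1; set N := #|[set _ | _]|.
have -> : #|[pred Y : {set T} | #|Y| == r.-1]| = N.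
  by apply: eq_card => Y; rewrite !inE.
rewrite -[(4 * _) *+ N]mulr_natr -(ler_nat rat) => Nb le1.
have t0 : 0 <= 4 * t%:R :> rat by rewrite mulr_ge0.
have {}Nb := ler_wpM2l t0 Nb.
have {}Bb : 32 * r%:R * B <= 32 * r%:R * (r * t * #|T| ^ r.-1)%:R.
  by rewrite ler_wpM2l // mulr_ge0 // ltW.
rewrite natrX in Nb; rewrite !natrM natrX in Bb.
rewrite -(ler_nat rat) !natrM natrD natrM !natrX.
have arith (g x B' N' u s : rat) : g <= 4 * u * N' + g / 2 + 32 * s * B' ->
    4 * u * N' <= 4 * u * x -> 32 * s * B' <= 32 * s * (s * u * x) ->
    g <= (8 + 64 * s ^+ 2) * u * x by lra.
exact: arith le1 Nb Bb.
Qed.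

End EvenCycle.

(** * The construction for the lower bound *)

Section OneVertexInSet.
Variables (T : finType) (S : {set T}) (r : nat).

Definition meet_once : {set {set T}} := [set e : {set T} | (#|e| == r) && (#|e :&: S| == 1%N)].

Lemma meet_once_uniform : uniform r meet_once.
Proof. by apply/forall_inP => e; rewrite inE => /andP[]. Qed.

(** A vertex of S and an (r - 1)-set outside S form an edge, and both are recovered from it by
    intersecting with S and by removing S. *)
Lemma card_meet_once : (0 < r)%N -> (#|S| * 'C(#|~: S|, r.-1) <= #|meet_once|)%N.
Proof.
move=> r0; rewrite -cards_draws -cardsX.
pose h (p : T * {set T}) := p.1 |: p.2.
have hS p : p \in setX S [set B : {set T} | B \subset ~: S & #|B| == r.-1] ->
    [/\ p.1 \in S, h p :&: S = [set p.1], h p :\: S = p.2 & #|p.2| = r.-1].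
  rewrite !inE => /andP[pS /andP[pB /eqP cB]].
  have BS y : y \in p.2 -> y \notin S by move/(subsetP pB); rewrite inE.
  split=> //; apply/setP => y; rewrite !inE; have [->|_] /= := eqVneq y p.1.
  - by rewrite pS.
  - by case: (boolP (y \in p.2)) => // /BS/negbTE.
  - by rewrite pS /=; case: (boolP (p.1 \in p.2)) => // /BS; rewrite pS.
  - by case: (boolP (y \in p.2)) => [/BS->|]; rewrite ?andbF.
rewrite -(@card_in_imset _ _ h); last first.
  move=> p q /hS[_ p1 p2 _] /hS[_ q1 q2 _] e.
  rewrite [p]surjective_pairing [q]surjective_pairing -p2 -q2 e; congr (_, _).
  by apply: set1_inj; rewrite -p1 e q1.
apply/subset_leq_card/subsetP => _ /imsetP[p /hS[pS p1 p2 cp] ->].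
rewrite inE p1 cards1 eqxx andbT /h cardsU1 cp.
have -> : p.1 \notin p.2 by rewrite -p2 inE pS.
by rewrite add1n prednK.
Qed.

(* In a copy, either all x_i lie in S or every Y_i meets S. *)
Lemma meet_once_even_cycle_free t : (#|S| < t)%N ->
  ~~ contains_copy (even_cycle r t) meet_once.
Proof.
move=> St; apply/negP => /existsP[f /andP[/injectiveP f_inj /forall_inP fG]].
have once x i : x |: cycle_block r i \in even_cycle r t ->
    #|[set v in x |: cycle_block r i | f v \in S]| = 1%N.
  move/fG; rewrite inE => /andP[_ /eqP <-].
  rewrite -(card_imset _ f_inj); apply: eq_card => y; apply/imsetP/setIP.
    by case=> v; rewrite inE => /andP[ve vS] ->; rewrite imset_f.
  by case=> /imsetP[v ve ->] vS; exists v; rewrite // inE ve.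
have e1 (i : 'I_t) : inl i |: cycle_block r i \in even_cycle r t.
  by apply/setUP; left; apply: imset_f.
have e2 (i : 'I_t) : inl (ordS i) |: cycle_block r i \in even_cycle r t.
  by apply/setUP; right; apply: imset_f.
pose hit (i : 'I_t) := [exists j, f (inr (i, j)) \in S].
(* Exactly one vertex of the edge is sent into S: either x_k or a vertex of Y_i. *)
have xor i k : inl k |: cycle_block r i \in even_cycle r t ->
    (f (inl k) \in S) = ~~ hit i.
  move/once/eqP/cards1P => [v ev].
  have inb u : (u \in inl k |: cycle_block r i) && (f u \in S) = (u == v).
    by move/setP/(_ u): ev; rewrite !inE.
  apply/idP/idP => [kS|].
    apply/existsP => -[j jS].
    have := inb (inl k); rewrite setU11 kS => /esym/eqP kv.
    have := inb (inr (i, j)); rewrite jS -kv inE imset_f ?orbT //.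
  move=> nh; have := inb v; rewrite eqxx => /andP[].
  move/setU1P => [->//|/imsetP[j _ ->] jS].
  by case/existsP: nh; exists j.
have t0 : (0 < t)%N by lia.
pose o := Ordinal t0.
(* Both edges through Y_i determine membership from [hit i] alone, so it passes from x_i to
   x_(i+1). *)
have step i : (f (inl (ordS i)) \in S) = (f (inl i) \in S).
  by rewrite (xor _ _ (e1 i)) (xor _ _ (e2 i)).
have const k (kt : (k < t)%N) : (f (inl (Ordinal kt)) \in S) = (f (inl o) \in S).
  elim: k kt => [|k IHk] kt; first by congr (f (inl _) \in S); apply: val_inj.
  have -> : Ordinal kt = ordS (Ordinal (ltnW kt)).
    by apply: val_inj; rewrite /= modn_small.
  by rewrite step IHk.
(* The images would be t distinct elements of S, which has fewer than t. *)
have too_many (g : 'I_t -> cycle_vertex r t) : injective g ->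
    ~ (forall i, f (g i) \in S).
  move=> g_inj gS; move: St; rewrite ltnNge => /negP; apply.
  rewrite -[leqLHS]card_ord -(card_imset _ (inj_comp f_inj g_inj)).
  by apply/subset_leq_card/subsetP => _ /imsetP[i _ ->]; apply: gS.
have [oS|oS] := boolP (f (inl o) \in S).
  by apply: (too_many (fun i => inl i)) => [i j []//|[k kt]]; rewrite const.
have all_hit i : hit i.
  apply: negbFE; rewrite -(xor _ _ (e1 i)).
  by case: i => k kt; rewrite const; apply: negbTE.
pose g i : cycle_vertex r t := inr (i, xchoose (existsP (all_hit i))).
apply: (too_many g) => [i j []//|i]; exact: (xchooseP (existsP (all_hit i))).
Qed.

End OneVertexInSet.

(** * The two bounds combined *)

Theorem theorem1p5 (R : realType) (r : nat) (hr : (3 <= r)%N) :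
  exists c C : R, 0 < c /\ 0 < C /\
    forall t : nat, (2 <= t)%N ->
      exists n0 : nat, forall n : nat, (n0 <= n)%N ->
        c * t%:R * n%:R ^+ r.-1 <= (ex_number r n (even_cycle r t))%:R
        /\ (ex_number r n (even_cycle r t))%:R <= C * t%:R * n%:R ^+ r.-1.
Proof.
(* The factor 2 comes from t <= 2(t - 1), the power 2^(r-1) from n <= 2(n - (t-1) - (r-1)), valid
   for n >= 2(t + r), and the factorial from passing between binomial coefficients and falling
   factorials. *)
pose K := (2 * 2 ^ r.-1 * r.-1`!)%N.
have K0 : (0 < K)%N by rewrite !muln_gt0 expn_gt0 fact_gt0.
exists (K%:R)^-1, (8 + 64 * r ^ 2)%:R; split; first by rewrite invr_gt0 ltr0n.
split; first by rewrite ltr0n addn_gt0.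
move=> t t2; exists (2 * (t + r))%N => n n0; split; last first.
  rewrite -natrX -!natrM ler_nat; apply/bigmax_leqP => G /andP[Gr Gfree].
  by have := even_cycle_free_card_leq Gr Gfree hr t2; rewrite card_ord.
have [S cS] : exists S : {set 'I_n}, #|S| = t.-1.
  have : (0 < #|[set S : {set 'I_n} | #|S| == t.-1]|)%N.
    by rewrite card_draws card_ord bin_gt0; lia.
  by case/card_gt0P => S; rewrite inE => /eqP; exists S.
apply: le_trans (_ : #|meet_once S r|%:R <= _); last first.
  rewrite ler_nat; apply: leq_bigmax_cond.
  by rewrite meet_once_uniform meet_once_even_cycle_free // cS; lia.
rewrite -mulrA ler_pdivrMl ?ltr0n // -natrX -!natrM ler_nat.
have := @card_meet_once _ S r; rewrite cS => cM.
apply: leq_trans (leq_mul (leqnn K) (cM _)); last by lia.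
have -> : #|~: S| = (n - t.-1)%N by have := cardsC S; rewrite card_ord cS; lia.
have pow_leq : (n ^ r.-1 <= 2 ^ r.-1 * ((n - t.-1) ^_ r.-1))%N.
  apply: leq_trans (leq_mul (leqnn _) (ffact_geq _ _)).
  by rewrite -expnMn leq_exp2r; lia.
apply: (@leq_trans (2 * t.-1 * (2 ^ r.-1 * ((n - t.-1) ^_ r.-1)))%N).
  by apply: leq_mul => //; lia.
by rewrite -bin_ffact /K eq_leq //; ring.
Qed.
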